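(* (a) $\mathcal M_0$ and $\overline{\mathcal M}_0$ are affine monoids, and $\overline{\mathcal M}_0$ is the normalization of $\mathcal M_0$. (b) For every reduced lift $a$, $\mathcal M_a$ and $\overline{\mathcal M}_a$ are finitely generated $\mathcal M_0$-modules, and $\mathcal M_a$ is a submodule of $\overline{\mathcal M}_a$.
   Context: **Graph and lattices.** $\Gamma$ is a connected negative definite plumbing tree with vertex set $\mathcal V$, all genera $0$, integer decorations $b_v$, which is the dual graph of the minimal good resolution of a normal surface singularity (so $b_v\le -2$ whenever the valency $\delta_v\le 2$). $L=\bigoplus_{v\in\mathcal V}\mathbb Z E_v$ has the negative definite form $(E_v,E_v)=b_v$, $(E_v,E_w)=1$ if $v\neq w$ are adjacent, $0$ otherwise. $L'=\{l'\in L\otimes\mathbb Q:(l',L)\subset\mathbb Z\}\supset L$ is freely generated by $E_v^*$, where $(E_v^*,E_w)=-1$ if $v=w$ and $0$ otherwise. **Nodes and Seifert invariants.** $\mathcal N=\{n:\delta_n\ge 3\}$ is the set of nodes (assumed nonempty), $\mathcal E=\{u:\delta_u=1\}$ the set of ends. For $n\in\mathcal N$, $\mathcal N_n$ is the set of nodes $n'\ne n$ such that the path from $n$ to $n'$ has no node in its interior $(n,n')$ (neighbouring nodes); $\mathcal E_n$ is the set of ends $u$ such that the path $(n,u]$ ($n$ excluded) contains no node. For a full subgraph, $\det$ denotes the determinant of the negative of its intersection matrix ($1$ for the empty graph). For $u\in\mathcal E_n$: $\alpha_u=\det_{(n,u]}$ and $\omega_u$ is the determinant of $(n,u]$ with the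 vertex adjacent to $n$ deleted. For $n'\in\mathcal N_n$: $\alpha_{n,n'}=\alpha_{n',n}=\det_{(n,n')}$ and $\omega_{n,n'}$ is the determinant of $(n,n')$ with the vertex adjacent to $n$ deleted; if $(n,n')=\emptyset$ put $\alpha_{n,n'}=1$, $\omega_{n,n'}=0$. **Reduced lifts.** For each pair of neighbouring nodes fix an order $n<n'$ or $n'<n$; sums over $n'>n$ or $n'<n$ run over neighbouring nodes $n'\in\mathcal N_n$, and ''$n<n'$'' always refers to neighbouring nodes. For $n<n'$, $n_{n'}$ is the vertex adjacent to $n$ on the path from $n$ to $n'$ ($n_{n'}=n'$ if $(n,n')=\emptyset$). A reduced lift is an element $a=\sum_{n\in\mathcal N}a_nE_n^*+\sum_{u\in\mathcal E}a_uE_u^*+\sum_{n<n'}a_{n_{n'}}E^*_{n_{n'}}\in L'$, given with its integer coefficients (coefficient $a_{n_{n'}}$ is kept separate from $a_{n'}$ if $(n,n')=\emptyset$); $a=0$ is the one with all coefficients $0$. **Sets attached to $a$.** $\mathbb Z^{\mathcal N}(a)=\{\ell=\sum_{n\in\mathcal N}\ell_nE_n:\ \ell_n\in\mathbb Z,\ \ell_n+\omega_{n',n}\ell_{n'}\equiv a_{n_{n'}}\ (\mathrm{mod}\ \alpha_{n,n'})\ \forall\, n<n'\}$. For $n\in\mathcal N$, $$N_a(\ell,n)=a_n+\sum_{n'>n}\frac{\omega_{n,n'}}{\alpha_{n,n'}}a_{n_{n'}}+\sum_{n'<n}\frac{1}{\alpha_{n,n'}}a_{n'_n}-\Big(b_n+\sum_{n'\in\mathcal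 N_n}\frac{\omega_{n,n'}}{\alpha_{n,n'}}\Big)\ell_n-\sum_{n'\in\mathcal N_n}\frac{\ell_{n'}}{\alpha_{n,n'}}+\sum_{u\in\mathcal E_n}\Big\lfloor\frac{a_u-\omega_u\ell_n}{\alpha_u}\Big\rfloor,$$ $\overline N_a(\ell,n)=N_a(\ell,n)+\sum_{u\in\mathcal E_n}\{(a_u-\omega_u\ell_n)/\alpha_u\}$ ($\{\cdot\}$ is the fractional part). $\mathcal M_a=\{\ell\in\mathbb Z^{\mathcal N}(a):N_a(\ell,n)\ge 0\ \forall n\in\mathcal N\}$, $\overline{\mathcal M}_a=\{\ell\in\mathbb Z^{\mathcal N}(a):\overline N_a(\ell,n)\ge 0\ \forall n\in\mathcal N\}$. **Monoid terminology.** An affine monoid is a finitely generated submonoid of some $\mathbb Z^d$. The normalization of an affine monoid $\mathcal M$ is the set of elements $x$ of the group generated by $\mathcal M$ such that $mx\in\mathcal M$ for some integer $m\ge1$. An $\mathcal M_0$-module here is a subset $\mathcal D\subset\mathbb Z\langle E_n\rangle_{n\in\mathcal N}$ with $\mathcal M_0+\mathcal D\subset\mathcal D$; it is finitely generated if $\mathcal D=\bigcup_{i=1}^s(d_i+\mathcal M_0)$ for finitely many $d_i\in\mathcal D$. *)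

(* Defs.v *)
From HB Require Import structures.
From mathcomp Require Import all_boot all_order all_algebra.
From mathcomp Require Import classical_sets.

Set Implicit Arguments.
Unset Strict Implicit.
Unset Printing Implicit Defensive.
Import Order.TTheory GRing.Theory Num.Theory.
Local Open Scope ring_scope.

Section AffineMonoids.

Definition submonoid (T : zmodType) (M : set T) : Prop :=
  M 0 /\ forall x y, M x -> M y -> M (x + y).

Definition fg_monoid (T : zmodType) (M : set T) : Prop :=
  exists s : seq T,
    M = [set x | exists c : T -> nat, x = \sum_(g <- s) g *+ c g]%classic.

(* The ambient group is Z^I for a finite index type I. *)
Definition affine_monoid (I : finType) (M : set {ffun I -> int}) : Prop :=
  submonoid M /\ fg_monoid M.

Definition subgroup (T : zmodType) (H : set T) : Prop :=
  H 0 /\ forall x y, H x -> H y -> H (x - y).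

Definition generated_group (T : zmodType) (M : set T) : set T :=
  [set x | forall H : set T, subgroup H -> (M `<=` H)%classic -> H x]%classic.

Definition normalization (T : zmodType) (M : set T) : set T :=
  [set x | generated_group M x /\ exists2 m : nat, (0 < m)%N & M (x *+ m)]%classic.

Definition is_module (T : zmodType) (M D : set T) : Prop :=
  forall m d, M m -> D d -> D (m + d).

Definition fg_module (T : zmodType) (M D : set T) : Prop :=
  is_module M D /\
  exists s : seq T, (forall d, d \in s -> D d) /\
    D = [set x | exists d m, [/\ d \in s, M m & x = d + m]]%classic.

Definition submodule (T : zmodType) (M D' D : set T) : Prop :=
  [/\ is_module M D', is_module M D & (D' `<=` D)%classic].

End AffineMonoids.

Record decorated_graph := DecoratedGraph {
  vert : finType;
  adj : rel vert;
  deco : vert -> int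
}.

Definition valency (G : decorated_graph) (v : vert G) : nat :=
  #|[set w | adj v w]|.

(* (E_v, E_w) *)
Definition inter (G : decorated_graph) (v w : vert G) : int :=
  if v == w then deco v else (adj v w)%:R.

Definition lattice_form (G : decorated_graph) (x y : {ffun vert G -> int}) : int :=
  \sum_v \sum_w x v * y w * inter v w.

(* By Grauert's theorem every connected negative definite tree (with all genera
   0) is the dual graph of a good resolution of a normal surface singularity;
   the last field expresses that this resolution is the minimal good one. *)
Record resolution_tree (G : decorated_graph) : Prop := ResolutionTree {
  adj_sym : symmetric (@adj G);
  adj_irr : irreflexive (@adj G);
  connectedG : forall v w : vert G, connect (@adj G) v w;
  acyclicG : forall c : seq (vert G),
    (2 < size c)%N -> ~ ucycle (@adj G) c;
  negative_definite : forall x : {ffun vert G -> int},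
    x != 0 -> lattice_form x x < 0;
  minimal_good : forall v : vert G, (valency v <= 2)%N -> deco v <= - 2%:Z
}.

Section Seifert.
Variable G : decorated_graph.
Implicit Types (v w : vert G) (A : {set vert G}).

Definition is_node v : bool := (3 <= valency v)%N.
Definition is_end v : bool := valency v == 1%N.

(* A simple path has at most #|vert G| vertices, whence the bounded sequences. *)
Definition closed_path v w : {set vert G} :=
  [set z | [exists p : {bseq #|vert G| of vert G},
     [&& path (@adj G) v p, uniq (v :: p), last v p == w & z \in v :: p]]].

(* (v, w] and (v, w) *)
Definition half_open_path v w : {set vert G} := closed_path v w :\ v.
Definition open_path v w : {set vert G} := closed_path v w :\ v :\ w.

Definition subgraph_det A : int :=
  \det (\matrix_(i < #|A|, j < #|A|) - inter (enum_val i) (enum_val j)).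

Definition delete_adjacent A v : {set vert G} := [set w in A | ~~ adj v w].

End Seifert.

Notation node G := {v : vert G | is_node v}.
Notation leaf G := {v : vert G | is_end v}.

Section SeifertInvariants.
Variable G : decorated_graph.
Implicit Types (n : node G) (u : leaf G).

(* n' \in N_n *)
Definition neighbour n (n' : node G) : bool :=
  (n' != n) && [forall v in open_path (val n) (val n'), ~~ is_node v].

(* u \in E_n *)
Definition end_of n u : bool :=
  [forall v in half_open_path (val n) (val u), ~~ is_node v].

Definition alpha_end n u : int := subgraph_det (half_open_path (val n) (val u)).
Definition omega_end n u : int :=
  subgraph_det (delete_adjacent (half_open_path (val n) (val u)) (val n)).

(* The empty path has alpha = 1, being the determinant of the empty graph. *)
Definition alpha n (n' : node G) : int := subgraph_det (open_path (val n) (val n')).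
Definition omega n (n' : node G) : int :=
  if open_path (val n) (val n') == finset.set0 then 0
  else subgraph_det (delete_adjacent (open_path (val n) (val n')) (val n)).

End SeifertInvariants.

(* A choice, for each pair of neighbouring nodes, of one of n < n', n' < n; it
   need not extend to an order on the set of all nodes. The values of lt on
   pairs that are not neighbours are irrelevant. *)
Definition neighbour_order (G : decorated_graph) (lt : rel (node G)) : Prop :=
  forall n n' : node G, neighbour n n' -> lt n n' (+) lt n' n.

(* The integer coefficients of a reduced lift: lift_edge n n' is the coefficient
   a_{n_{n'}} for neighbours n < n', and is irrelevant for other pairs. The
   element of L' itself is the combination of the E_v^* with these coefficients;
   M_a and its variants depend only on the coefficients. *)
Record reduced_lift (G : decorated_graph) := ReducedLift {
  lift_node : node G -> int;
  lift_end : leaf G -> int;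
  lift_edge : node G -> node G -> int
}.

Definition zero_lift (G : decorated_graph) : reduced_lift G :=
  ReducedLift (fun=> 0) (fun=> 0) (fun _ _ => 0).

Definition frac (x : rat) : rat := x - (Num.floor x)%:~R.

Section Sets.
Variables (G : decorated_graph) (lt : rel (node G)) (a : reduced_lift G).
Implicit Types (n : node G) (l : {ffun node G -> int}).

Definition node_lt n (n' : node G) : bool := neighbour n n' && lt n n'.

(* Z^N(a) *)
Definition congruence_set : set {ffun node G -> int} :=
  [set l | forall n n', node_lt n n' ->
     (l n + omega n' n * l n' = lift_edge a n n' %[mod alpha n n'])%Z]%classic.

Definition omega_alpha n (n' : node G) : rat := (omega n n')%:~R / (alpha n n')%:~R.

Definition end_term l n (u : leaf G) : rat :=
  (lift_end a u - omega_end n u * l n)%:~R / (alpha_end n u)%:~R.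

Definition Nfun l n : rat :=
  (lift_node a n)%:~R
  + (\sum_(n' | node_lt n n') omega_alpha n n' * (lift_edge a n n')%:~R)
  + (\sum_(n' | node_lt n' n) (alpha n n')%:~R^-1 * (lift_edge a n' n)%:~R)
  - ((deco (val n))%:~R + \sum_(n' | neighbour n n') omega_alpha n n') * (l n)%:~R
  - (\sum_(n' | neighbour n n') (l n')%:~R / (alpha n n')%:~R)
  + (\sum_(u | end_of n u) (Num.floor (end_term l n u))%:~R).

Definition Nbar l n : rat :=
  Nfun l n + \sum_(u | end_of n u) frac (end_term l n u).

Definition Mset : set {ffun node G -> int} :=
  [set l | congruence_set l /\ forall n, 0 <= Nfun l n]%classic.

Definition Mbar : set {ffun node G -> int} :=
  [set l | congruence_set l /\ forall n, 0 <= Nbar l n]%classic.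

End Sets.

(* Main.v *)
From mathcomp Require Import boolp classical_sets.
From mathcomp Require Import all_boot all_order all_algebra all_fingroup.
From mathcomp Require Import zify ring lra.
Require Import Defs.

Set Implicit Arguments.
Unset Strict Implicit.
Unset Printing Implicit Defensive.
Import Order.TTheory GRing.Theory Num.Theory.
Local Open Scope ring_scope.

(** The function [Nbar a] is affine: it is a constant plus a linear form in
    [l], whose matrix, indexed by the nodes, is minus the orbifold intersection
    matrix of the graph. The function [Nfun a] differs from it by a sum of
    fractional parts, which is bounded, and periodic modulo a common multiple
    [m] of all the Seifert invariants [alpha]. What has to be known about the
    graph is that the orbifold matrix is invertible and that the [alpha] are
    nonzero.

    The [alpha] are determinants of chains, that is continuants in the
    decorations, and these increase along a chain of decorations at most -2
    ([continuant_gt_tail]). Invertibility comes from the whole intersection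
    form, which is nondegenerate because it is negative definite: multiples of
    the dual vectors [E_v^*] exist in the lattice ([dual_vectors]). A vector
    orthogonal to all [E_w] with [w] not a node satisfies a three-term
    recurrence along each chain, and solving it by continuants shows that its
    values at two neighbouring nodes determine its value at the first vertex of
    the chain between them ([alpha_first_step], [alpha_end_first_step]).
    In a tree the edges at a node correspond bijectively to the neighbouring
    nodes and the ends that it reaches ([sum_adj_node]), so the pairing of such
    a vector with [E_n] is, up to sign, the orbifold form of its restriction to
    the nodes ([orbifold_form_restriction]). Restricting multiples of the
    [E_n^*] therefore gives vectors [v_n], divisible by [m], at which the
    orbifold form is [k] times the [n]-th unit vector ([dual_basis]).

    The rest is an argument about lattice points. Adding [v_n] respects the
    congruences, since [m] divides it, changes the value of [Nfun] or [Nbar]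
    at [n] by [k], and leaves the values at the other nodes alone, so
    subtracting multiples of the [v_n] from an element of [Mset a] or [Mbar a]
    leads to an element of the same set at which all the values of [Nfun a] or
    [Nbar a] lie in the interval from 0 to [k]. There are finitely many such
    elements, and they generate, together with the [v_n], which belong to
    [Mset 0] ([region_decomposition]). Superadditivity of the floor function
    gives the module structures. For the normalization, multiplication by [m]
    kills all fractional parts, so it sends [Mbar 0] into [Mset 0]; and adding
    to [x] in [Mbar 0] a large sum [y] of the [v_n] lands in [Mset 0], so that
    [x = (x + y) - y] lies in the group that [Mset 0] generates. *)

(** * Determinants of chains *)

(** The determinant of minus the intersection matrix of a chain with the
    decorations [s]; it is given by its expansion along the first row. *)
Fixpoint continuant (s : seq int) : int :=
  if s is b :: s' then
    - b * continuant s' - (if s' is _ :: s'' then continuant s'' else 0)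
  else 1.

(** The Seifert invariant [omega] of a chain. Its value 0 on the empty chain
    is the convention for adjacent nodes. *)
Definition continuant_tail (s : seq int) : int :=
  if s is _ :: s' then continuant s' else 0.

Lemma continuant_cons b s :
  continuant (b :: s) = - b * continuant s - continuant_tail s.
Proof. by []. Qed.

(** The difference of consecutive continuants does not decrease when a
    decoration at most -2 is put in front. *)
Lemma continuant_gt_tail s : all (fun b => b <= - 2%:Z) s ->
  0 <= continuant_tail s < continuant s.
Proof.
elim: s => [|b s IHs] // /andP[b_le /IHs/andP[]]; rewrite continuant_cons /=.
move: (continuant_tail s) (continuant s) => t c t_ge0 t_lt.
have : 0 <= (- b - 2) * c by apply: mulr_ge0; lia.
by move=> ?; apply/andP; split; lia.
Qed.

Lemma continuant_gt0 s : all (fun b => b <= - 2%:Z) s -> 0 < continuant s.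
Proof. by move=> /continuant_gt_tail /andP[]; exact: le_lt_trans. Qed.

(** One step of the elimination of the interior values of a three-term
    recurrence with coefficients [b :: s]: here [x0], [x1], [x2] are consecutive
    values and [e] is the contribution of the far end of the chain. *)
Lemma continuant_solve b s (x0 x1 x2 e : int) :
    b * x1 + (x0 + x2) = 0 ->
    continuant s * x2 = continuant_tail s * x1 + e ->
  continuant (b :: s) * x1 = continuant_tail (b :: s) * x0 + e.
Proof.
move=> eq_b eq_s; rewrite continuant_cons [continuant_tail (_ :: _)]/=.
have -> : x0 = - b * x1 - x2 by lia.
by rewrite mulrBr mulrBl -addrA -mulrA mulrCA; lia.
Qed.

(** Laplace expansion of a matrix that is tridiagonal in its first row and
    first column. *)
Lemma det_first_row_col2 (R : comNzRingType) n (A : 'M[R]_n.+2) :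
    (forall j, A 0 (lift ord0 (lift ord0 j)) = 0) ->
    (forall i, A (lift ord0 (lift ord0 i)) 0 = 0) ->
  \det A = A 0 0 * \det (row' ord0 (col' ord0 A))
           - A 0 1 * A 1 0 * \det (row' ord0 (col' ord0 (row' ord0 (col' ord0 A)))).
Proof.
move=> row0 col0; rewrite (expand_det_row _ ord0) 2!big_ord_recl.
rewrite big1 ?addr0; last first.
  by move=> j _; rewrite row0 mul0r.
rewrite {1}/cofactor addn0 expr0 mul1r; congr (_ + _).
have -> : lift ord0 (ord0 : 'I_n.+1) = 1 by apply: val_inj.
rewrite -mulrA -mulrN; congr (_ * _).
rewrite /cofactor add0n expr1 mulN1r; congr (- _).
rewrite (expand_det_col _ ord0) big_ord_recl big1 ?addr0; last first.
  move=> i _; rewrite !mxE.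
  have -> : lift (1 : 'I_n.+2) ord0 = 0 by apply: val_inj.
  by rewrite col0 mul0r.
rewrite /cofactor addn0 expr0 mul1r !mxE.
have -> : lift (1 : 'I_n.+2) ord0 = 0 by apply: val_inj.
have -> : lift ord0 (ord0 : 'I_n.+1) = 1 by apply: val_inj.
congr (_ * \det _); apply/matrixP=> i j; rewrite !mxE; congr (A _ _).
by apply: val_inj; rewrite /= /bump /=; lia.
Qed.

Definition seq_mx (G : decorated_graph) (p : seq (vert G)) : 'M[int]_(size p) :=
  \matrix_(i, j) - inter (tnth (in_tuple p) i) (tnth (in_tuple p) j).

(** Two enumerations of the same vertices differ by a permutation, which acts
    on rows and columns at once and so does not change the determinant. *)
Lemma subgraph_det_seq (G : decorated_graph) (p : seq (vert G)) :
  uniq p -> subgraph_det [set w in p] = \det (seq_mx p).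
Proof.
move=> p_uniq; set A := [set w in p].
have card_A : #|A| = size p by rewrite cardsE; apply/card_uniqP.
have memA (i : 'I_#|A|) : enum_val i \in p by move: (enum_valP i); rewrite inE.
have ltA (i : 'I_#|A|) : (index (enum_val i) p < size p)%N by rewrite index_mem.
pose f i := Ordinal (ltA i).
have fE i : tnth (in_tuple p) (f i) = enum_val i.
  by rewrite (tnth_nth (enum_val i)) /= nth_index.
have f_inj : injective f by move=> i j eq_f; apply: enum_val_inj; rewrite -!fE eq_f.
have -> : subgraph_det A = \det (\matrix_(i, j) seq_mx p (f i) (f j)).
  by congr (\det _); apply/matrixP=> i j; rewrite !mxE !fE.
clearbody f; clear fE ltA; move: (seq_mx p) f f_inj.
rewrite -{}card_A => B f f_inj.
pose s := perm f_inj.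
have -> : \matrix_(i, j) B (f i) (f j) = row_perm s (col_perm s B).
  by apply/matrixP=> i j; rewrite !mxE !permE.
rewrite row_permE col_permE !det_mulmx !det_perm odd_permV mulrCA.
by rewrite -signr_addb addbb mulr1.
Qed.

(** * Simple paths in the tree *)

Section Tree.
Variables (G : decorated_graph) (hG : resolution_tree G).
Implicit Types (v w y z : vert G) (p q : seq (vert G)).

Let adjC : symmetric (@adj G) := adj_sym hG.

Lemma adj_neq v w : adj v w -> v != w.
Proof. by apply: contraTneq => ->; rewrite (adj_irr hG). Qed.

(** Otherwise a simple path from [w] to [w'] that avoids [v] would be closed
    up to a cycle by [v]. *)
Lemma no_detour v w w' q :
    adj v w -> adj v w' -> path (@adj G) w q -> last w q = w' ->
  v \notin w :: q -> w = w'.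
Proof.
move=> vw vw' wq last_q; case/shortenP: wq last_q => r wr r_uniq r_sub last_r v_notin.
apply/eqP/idPn => w_neq; case: (acyclicG hG (c := v :: w :: r)).
  by case: r last_r {wr r_uniq r_sub} => [/= eq_w|//]; rewrite eq_w eqxx in w_neq.
apply/andP; split; first by rewrite /= rcons_path vw wr last_r adjC.
rewrite [uniq _]/= -/(uniq (w :: r)) r_uniq andbT.
by apply: contra v_notin; rewrite !inE => /orP[->//|/r_sub ->]; rewrite orbT.
Qed.

(** Where two simple paths with the same ends separate, following one to the
    end and the other back is a detour around the separation point. *)
Lemma simple_path_unique v p q :
    path (@adj G) v p -> path (@adj G) v q -> uniq (v :: p) -> uniq (v :: q) ->
  last v p = last v q -> p = q.
Proof.
elim: p v q => [|w p IHp] v [|w' q] //.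
- move=> _ _ _ /= /andP[v_notin _] eq_v; move: v_notin.
  by rewrite eq_v mem_last.
- move=> _ _ /= /andP[v_notin _] _ eq_v; move: v_notin.
  by rewrite -eq_v mem_last.
move=> /= /andP[vw wp] /andP[vw' w'q] /andP[v_p p_uniq] /andP[v_q q_uniq] eq_last.
have eq_w : w = w'.
  (* Follow the first path to the common end, then the second one backwards. *)
  apply: (no_detour (q := p ++ rev (belast w' q)) vw vw').
  - rewrite cat_path wp eq_last rev_path.
    by rewrite (eq_path (e' := @adj G)) // => x y; rewrite adjC.
  - rewrite last_cat eq_last; case: q {IHp w'q v_q q_uniq eq_last} => //= t q.
    by rewrite rev_cons last_rcons.
  apply: contra v_q; rewrite -cat_cons mem_cat (negPf v_p) mem_rev /=.
  exact: mem_belast.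
by subst w'; congr (_ :: _); apply: (IHp w).
Qed.

Lemma closed_pathE v p : path (@adj G) v p -> uniq (v :: p) ->
  closed_path v (last v p) = [set z in v :: p].
Proof.
move=> vp p_uniq; apply/setP=> z; rewrite !inE; apply/existsP/idP.
  move=> [q /and4P[vq q_uniq /eqP eq_last]].
  by rewrite (simple_path_unique vq vp q_uniq p_uniq eq_last) inE.
move=> z_p; have size_p : (size p <= #|vert G|)%N.
  have /card_uniqP <- : uniq p by case/andP: p_uniq.
  exact: max_card.
by exists (Bseq size_p); rewrite /= vp eqxx inE z_p !andbT.
Qed.

(** The interior vertices [p] of a chain have valency at most two; [v] and [z]
    themselves are arbitrary. *)
Definition chain v p z :=
  [&& path (@adj G) v (rcons p z), uniq (v :: rcons p z)
    & all (fun w => ~~ is_node w) p].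

Lemma open_path_chain v p z : chain v p z -> open_path v z = [set w in p].
Proof.
case/and3P=> vp p_uniq _; have := closed_pathE vp p_uniq.
rewrite last_rcons /open_path => ->; apply/setP=> w; rewrite !inE mem_rcons inE.
move: p_uniq; rewrite /= mem_rcons inE negb_or rcons_uniq.
case/and3P=> /andP[_ v_p] z_p _.
case: (eqVneq w z) => [->|_] /=; first by rewrite (negPf z_p).
by case: (eqVneq w v) => [->|_] //=; rewrite (negPf v_p).
Qed.

Lemma half_open_path_chain v p z : chain v p z ->
  half_open_path v z = [set w in rcons p z].
Proof.
case/and3P=> vp p_uniq _; have := closed_pathE vp p_uniq.
rewrite last_rcons /half_open_path => ->; apply/setP=> w; rewrite !inE.
by case: (eqVneq w v) => [->|_] //=; case/andP: p_uniq => /negPf ->.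
Qed.

Lemma chain_exists v z : v != z ->
    {in open_path v z, forall w, ~~ is_node w} -> exists p, chain v p z.
Proof.
move=> v_neq no_node; have /connectP[p0 vp0 eq_z] := connectedG hG v z.
case/shortenP: vp0 eq_z => p vp p_uniq _ eq_z.
case/lastP: p => [|p t] in vp p_uniq eq_z *; first by rewrite eq_z eqxx in v_neq.
rewrite last_rcons in eq_z; rewrite -{}eq_z in vp p_uniq; exists p.
rewrite /chain vp p_uniq; apply/allP=> w w_p; apply: no_node.
have := closed_pathE vp p_uniq; rewrite last_rcons /open_path => ->.
rewrite !inE mem_rcons inE w_p !orbT andbT.
move: p_uniq; rewrite /= mem_rcons inE negb_or rcons_uniq.
case/and3P=> /andP[_ v_p] z_p _; apply/andP; split.
  by apply: contraNneq z_p => <-.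
by apply: contraNneq v_p => <-.
Qed.

(** A tree has no chords, so simple paths are induced. *)
Lemma adj_path_head v q w : path (@adj G) v q -> uniq (v :: q) ->
  w \in q -> adj v w -> w = head v q.
Proof.
case: q => // w1 q /= /andP[vw1 w1q] /andP[v_q q_uniq].
rewrite inE => /orP[/eqP //|w_q] vw.
case/splitPr: w_q w1q v_q {q_uniq} => q1 q2.
rewrite -cat_rcons cat_path => /andP[w1q _] v_q; apply/esym.
apply: (no_detour vw1 vw w1q); first by rewrite last_rcons.
by apply: contra v_q; rewrite !inE mem_cat orbA => ->.
Qed.

End Tree.

(** * The directions leaving a node *)

Section Directions.
Variables (G : decorated_graph) (hG : resolution_tree G).
Implicit Types (v w y z : vert G) (p q : seq (vert G)) (n : node G).

Let adjC : symmetric (@adj G) := adj_sym hG.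

Lemma nonnode_nbrs w y z : ~~ is_node w -> adj w y -> adj w z -> y != z ->
  [set x | adj w x] = [set y; z].
Proof.
rewrite -ltnNge ltnS => val_w wy wz y_neq; apply/eqP; rewrite eq_sym eqEcard.
rewrite cards2 y_neq val_w andbT; apply/subsetP=> x.
by rewrite !inE => /orP[] /eqP ->.
Qed.

Lemma end_nbrs w y : is_end w -> adj w y -> [set x | adj w x] = [set y].
Proof.
move=> /eqP val_w wy; apply/eqP; rewrite eq_sym eqEcard cards1.
by rewrite -[X in _ && (X <= _)%N]/(valency w) val_w andbT sub1set inE.
Qed.

Lemma end_nonnode w : is_end w -> ~~ is_node w.
Proof. by rewrite /is_node => /eqP ->. Qed.

(** The possible ends of the branches at a node, before the next branching. *)
Definition dest : Type := (node G + leaf G)%type.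

Definition dest_vert (d : dest) : vert G :=
  match d with inl n => val n | inr u => val u end.

Definition reached n (d : dest) : bool :=
  match d with inl n' => neighbour n n' | inr u => end_of n u end.

Lemma dest_vert_inj : injective dest_vert.
Proof.
move=> [n|u] [n'|u'] /= eq_v.
- by congr inl; apply: val_inj.
- by have := valP n; rewrite /= eq_v (negPf (end_nonnode (valP u'))).
- by have := valP n'; rewrite /= -eq_v (negPf (end_nonnode (valP u))).
- by congr inr; apply: val_inj.
Qed.

Lemma dest_vertP d : is_node (dest_vert d) || is_end (dest_vert d).
Proof. by case: d => [n|u]; rewrite (valP _) ?orbT. Qed.

Lemma reachedP n d :
  reflect (exists p, chain (val n) p (dest_vert d)) (reached n d).
Proof.
case: d => [n'|u] /=; apply: (iffP idP).
- case/andP=> n_neq /forall_inP no_node; apply: (chain_exists hG) => //.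
  by apply: contraNneq n_neq => eq_n; apply/eqP/val_inj.
- case=> p np; apply/andP; split.
    apply: contraTneq np => ->; rewrite /chain /= mem_rcons inE eqxx.
    by rewrite andbF.
  apply/forall_inP=> w; rewrite (open_path_chain hG np) inE => w_p.
  by case/and3P: np => _ _ /allP; apply.
- move=> /forall_inP no_node; apply: (chain_exists hG).
    by apply: contraNneq (end_nonnode (valP u)) => /= <-; exact: valP n.
  move=> w; rewrite /open_path in_setD1 => /andP[_]; exact: no_node.
- case=> p np; apply/forall_inP=> w; rewrite (half_open_path_chain hG np) inE.
  rewrite mem_rcons inE => /orP[/eqP ->|w_p]; first exact: end_nonnode (valP u).
  by case/and3P: np => _ _ /allP; apply.
Qed.

Lemma chain_cons v w p z :
  chain v (w :: p) z -> [/\ adj v w, ~~ is_node w, v != head z p & chain w p z].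
Proof.
case/and3P=> /= /andP[-> wp] /andP[v_p p_uniq] /andP[-> p_all].
split=> //; last by apply/and3P.
by apply: contraNneq v_p => ->; case: p {wp p_uniq p_all} => [|t p] /=;
  rewrite !inE eqxx ?orbT.
Qed.

Lemma chain_head v p z : chain v p z -> adj v (head z p).
Proof. by case: p => [|w p] /and3P[/= /andP[]]. Qed.

Lemma chain_nbrs v w p z : chain v (w :: p) z ->
  [set x | adj w x] = [set v; head z p].
Proof.
case/chain_cons=> vw w_nonnode v_neq wp.
by apply: nonnode_nbrs => //; [rewrite adjC | exact: chain_head wp].
Qed.

(** Since interior vertices have only two neighbours, the first step decides
    all the others until the chain stops. *)
Lemma chain_deterministic v p p' z z' :
    is_node z || is_end z -> is_node z' || is_end z' ->
    chain v p z -> chain v p' z' -> head z p = head z' p' -> z = z'.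
Proof.
(* A node or an end cannot be interior to a chain. *)
have stop y q w t : is_node y || is_end y -> chain w (y :: q) t -> False.
  move=> y_stop wq; have [_ y_nonnode w_neq _] := chain_cons wq.
  move: y_stop; rewrite (negPf y_nonnode) /= /is_end /valency (chain_nbrs wq).
  by rewrite cards2 w_neq.
move=> z_stop z'_stop; elim: p v p' => [|w p IHp] v [|w' p'] //=.
- by move=> _ vp' eq_z; rewrite eq_z in z_stop; case: (stop _ _ _ _ z_stop vp').
- by move=> vp _ eq_z; rewrite -eq_z in z'_stop; case: (stop _ _ _ _ z'_stop vp).
move=> vp vp' eq_w; subst w'; have [_ _ v_neq wp] := chain_cons vp.
have [_ _ v_neq' wp'] := chain_cons vp'.
apply: IHp wp wp' _; have := chain_nbrs vp.
rewrite (chain_nbrs vp') => /setP/(_ (head z p)).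
by rewrite !inE eqxx orbT ![head z p == _]eq_sym (negPf v_neq) => /eqP.
Qed.

(** A chain cannot run back into itself, as this would close a cycle. *)
Lemma chain_rcons v p z z' : chain v p z -> ~~ is_node z -> adj z z' ->
  z' != last v p -> chain v (rcons p z) z'.
Proof.
case/and3P=> vp p_uniq p_all z_nonnode zz' z'_neq.
apply/and3P; split; last by rewrite all_rcons z_nonnode.
  by rewrite rcons_path vp last_rcons.
rewrite -rcons_cons rcons_uniq p_uniq andbT.
apply/negP; rewrite -rcons_cons mem_rcons inE => /orP[/eqP eq_z|z'_p].
  by move: zz'; rewrite eq_z (adj_irr hG).
have z_last : adj z (last v p) by move: vp; rewrite rcons_path adjC => /andP[].
move: vp p_uniq.
rewrite rcons_path -rcons_cons rcons_uniq => /andP[vp _] /andP[z_p _].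
case/splitPl: z'_p vp z_p z'_neq z_last => p1 p2 eq_z'.
rewrite cat_path last_cat eq_z' => /andP[_ vp2] z_p z'_neq z_last.
suff eq_last : z' = last z' p2 by rewrite -eq_last eqxx in z'_neq.
apply: (no_detour hG zz' z_last vp2) => //.
apply: contra z_p; rewrite -eq_z' inE -cat_cons mem_cat => /orP[/eqP ->|->].
  by rewrite mem_last.
by rewrite orbT.
Qed.

(** A chain that has not reached a node or an end can be prolonged at its last
    vertex, which has valency two; finiteness of the graph stops this. *)
Lemma chain_extend v p z : chain v p z ->
  exists p' d, chain v p' (dest_vert d) /\ head z p = head (dest_vert d) p'.
Proof.
have [m] := ubnP (#|vert G| - size p); elim: m p z => // m IHm p z lt_m vp.
have [z_node|z_nonnode] := boolP (is_node z).
  by exists p, (inl (exist _ z z_node)).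
have [z_end|z_nend] := boolP (is_end z).
  by exists p, (inr (exist _ z z_end)).
have size_p : (size p < #|vert G|)%N.
  case/and3P: vp => _ /card_uniqP p_card _.
  by have := max_card (mem (v :: rcons p z)); rewrite p_card /= size_rcons; lia.
have z_last : last v p \in [set x | adj z x].
  by case/and3P: vp; rewrite rcons_path inE adjC => /andP[].
(* The last vertex has a neighbour other than its predecessor. *)
have /card_gt0P[z'] : (0 < #|[set x | adj z x] :\ last v p|)%N.
  move: z_nend z_nonnode; rewrite /is_end /is_node /valency.
  by rewrite [in X in X -> _](cardsD1 (last v p)) z_last; lia.
rewrite !inE => /andP[z'_neq zz'].
have vp' := chain_rcons vp z_nonnode zz' z'_neq.
have [|p' [d [vp'' eq_head]]] := IHm _ _ _ vp'; first by rewrite size_rcons; lia.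
by exists p', d; split; rewrite // -eq_head; case: (p).
Qed.

(** The default value [val n] is never taken on reached destinations. *)
Definition first_step n d : vert G :=
  odflt (val n)
    [pick w | adj (val n) w && (w \in closed_path (val n) (dest_vert d))].

Lemma first_stepE n d p :
  chain (val n) p (dest_vert d) -> first_step n d = head (dest_vert d) p.
Proof.
move=> np; have n_head := chain_head np; case/and3P: np => np p_uniq _.
have closedE := closed_pathE hG np p_uniq; rewrite last_rcons in closedE.
rewrite /first_step; case: pickP => [w|/(_ (head (dest_vert d) p))].
  rewrite closedE !inE => /andP[nw]; case/orP=> [/eqP eq_w|w_p].
    by move: nw; rewrite eq_w (adj_irr hG).
  by rewrite (adj_path_head hG np p_uniq w_p nw); case: (p).
rewrite n_head closedE !inE /=; case: (p) => [|t q] /=.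
  by rewrite !inE eqxx !orbT.
by rewrite !inE eqxx !orbT.
Qed.

Lemma first_step_inj n : {in [set d | reached n d] &, injective (first_step n)}.
Proof.
move=> d d'; rewrite !inE => /reachedP[p np] /reachedP[p' np'].
rewrite (first_stepE np) (first_stepE np') => eq_head; apply: dest_vert_inj.
exact: chain_deterministic (dest_vertP d) (dest_vertP d') np np' eq_head.
Qed.

Lemma first_step_imset n :
  first_step n @: [set d | reached n d] = [set w | adj (val n) w].
Proof.
apply/setP=> w; apply/imsetP/idP => [[d]|]; rewrite !inE.
  by move=> /reachedP[p np] ->; rewrite (first_stepE np); exact: chain_head np.
move=> nw; have np : chain (val n) [::] w.
  by rewrite /chain /= nw !andbT inE (adj_neq hG nw).
have [p [d [np' /= ->]]] := chain_extend np.
exists d; last by rewrite (first_stepE np').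
by rewrite inE; apply/reachedP; exists p.
Qed.

(** The edges at a node are in bijection with the destinations it reaches:
    each edge leads to one by [chain_extend], to only one by
    [chain_deterministic]. *)
Lemma sum_adj_node n (R : nmodType) (F : vert G -> R) :
  \sum_(w | adj (val n) w) F w =
  \sum_(n' | neighbour n n') F (first_step n (inl n'))
  + \sum_(u | end_of n u) F (first_step n (inr u)).
Proof.
rewrite -big_set -first_step_imset big_imset /=; last exact: first_step_inj.
by rewrite big_set big_sumType.
Qed.

End Directions.

(** * The orbifold intersection form *)

Section Seifert.
Variables (G : decorated_graph) (hG : resolution_tree G).
Implicit Types (v w y z : vert G) (p q : seq (vert G)) (n : node G).
Implicit Types (x : vert G -> int).

(** The intersection number of [E_w] with the sum of the [x z] [E_z]. *)
Definition pairing x w : int := \sum_z inter w z * x z.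

Lemma pairingE x w : pairing x w = deco w * x w + \sum_(z | adj w z) x z.
Proof.
rewrite /pairing (bigD1 w) //= {1}/inter eqxx; congr (_ + _).
rewrite big_mkcond [RHS]big_mkcond; apply: eq_bigr => z _.
rewrite /inter eq_sym; case: eqVneq => [->|_] /=.
  by rewrite (adj_irr hG).
by case: adj; rewrite ?mul1r ?mul0r.
Qed.

Lemma interC v w : inter v w = inter w v.
Proof. by rewrite /inter eq_sym (adj_sym hG); case: eqVneq => [->|]. Qed.

(** Orthogonality to [E_w] is the three-term recurrence at [w], because the
    neighbours of [w] are its two neighbours in the chain. *)
Lemma chain_relation x v p z : chain v p z -> {in p, forall w, pairing x w = 0} ->
  continuant (map (@deco G) p) * x (head z p) =
  continuant_tail (map (@deco G) p) * x v + x z.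
Proof.
elim: p v => [|w p IHp] v vp harm; first by rewrite /= mul1r mul0r add0r.
have [_ _ v_neq wp] := chain_cons vp.
have eq_w := pairingE x w; rewrite harm ?mem_head // in eq_w.
rewrite -big_set (chain_nbrs hG vp) big_setU1 ?inE // big_set1 in eq_w.
apply: continuant_solve (esym eq_w) _; apply: IHp => // t t_p.
by apply: harm; rewrite inE t_p orbT.
Qed.

(** As [chain_relation], but the end [u] is also eliminated; the recurrence
    there has no outer term. *)
Lemma leg_relation x v p u : chain v p u -> is_end u ->
    {in rcons p u, forall w, pairing x w = 0} ->
  continuant (map (@deco G) (rcons p u)) * x (head u p) =
  continuant_tail (map (@deco G) (rcons p u)) * x v.
Proof.
move=> vp u_end; elim: p v vp => [|w p IHp] v vp harm.
  have uv : adj u v by case/and3P: vp => /=; rewrite andbT (adj_sym hG).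
  have := pairingE x u; rewrite harm ?mem_head // -big_set (end_nbrs u_end uv).
  by rewrite big_set1 /= mul1r mulr1 subr0 => eq_u; rewrite mulNr; lia.
have [_ _ v_neq wp] := chain_cons vp.
have eq_w := pairingE x w; rewrite harm ?mem_head // in eq_w.
rewrite -big_set (chain_nbrs hG vp) big_setU1 ?inE // big_set1 in eq_w.
rewrite -[RHS]addr0; apply: continuant_solve (esym eq_w) _; rewrite addr0.
by apply: IHp => // t t_p; apply: harm; rewrite rcons_cons inE t_p orbT.
Qed.

Lemma path_not_adj v w q : path (@adj G) v (w :: q) -> uniq [:: v, w & q] ->
  {in q, forall t, ~~ adj v t}.
Proof.
move=> vq q_uniq t t_q; apply/negP => vt.
have := adj_path_head hG vq q_uniq _ vt; rewrite inE t_q orbT => /(_ isT) /= eq_t.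
by move: q_uniq; rewrite /= -eq_t t_q /= andbF.
Qed.

(** A simple path has no chords, so its matrix is tridiagonal. *)
Lemma det_seq_mx v q : path (@adj G) v q -> uniq (v :: q) ->
  \det (seq_mx q) = continuant (map (@deco G) q).
Proof.
have [m] := ubnP (size q); elim: m q v => // m IHm [|w q] v.
  by move=> _ _ _; rewrite det_mx00.
case: q => [|w' q].
  by move=> _ _ _; rewrite det_mx11 !mxE (tnth_nth w) /= /inter eqxx mulr1 subr0.
move=> lt_m /= /andP[_ wq] /andP[_ q_uniq].
have [/= ww' w'q] := andP wq; have /= /andP[w_q w'q_uniq] := q_uniq.
rewrite (det_first_row_col2 (n := size q)).
- have -> : row' ord0 (col' ord0 (seq_mx [:: w, w' & q])) = seq_mx (w' :: q).
    by apply/matrixP=> i j; rewrite !mxE !(tnth_nth w).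
  have -> : row' ord0 (col' ord0 (seq_mx (w' :: q))) = seq_mx q.
    by apply/matrixP=> i j; rewrite !mxE !(tnth_nth w).
  rewrite (IHm (w' :: q) w) // (IHm q w') //; last by apply: ltnW.
  rewrite !mxE !(tnth_nth w) /= /inter !eqxx (adj_sym hG w') ww'.
  rewrite [w' == w]eq_sym; move: w_q; rewrite inE negb_or => /andP[/negPf -> _].
  by rewrite mulrNN mulr1 mul1r.
- move=> j; rewrite !mxE !(tnth_nth w) /=.
  have t_q : nth w q j \in q by rewrite mem_nth.
  rewrite /inter (negPf (path_not_adj wq q_uniq t_q)) ifN ?oppr0 //.
  by apply: contraNneq w_q => eq_t; rewrite inE [in X in _ || X]eq_t t_q orbT.
move=> j; rewrite !mxE !(tnth_nth w) /=.
have t_q : nth w q j \in q by rewrite mem_nth.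
rewrite interC /inter (negPf (path_not_adj wq q_uniq t_q)) ifN ?oppr0 //.
by apply: contraNneq w_q => eq_t; rewrite inE [in X in _ || X]eq_t t_q orbT.
Qed.

Lemma subgraph_det_path v q : path (@adj G) v q -> uniq (v :: q) ->
  subgraph_det [set w in q] = continuant (map (@deco G) q).
Proof.
move=> vq q_uniq; rewrite subgraph_det_seq; last by case/andP: q_uniq.
exact: det_seq_mx vq q_uniq.
Qed.

(** The only vertex of [q] adjacent to [v] is the first one. *)
Lemma subgraph_det_path_tail v q : path (@adj G) v q -> uniq (v :: q) -> q != [::] ->
  subgraph_det (delete_adjacent [set w in q] v) = continuant_tail (map (@deco G) q).
Proof.
case: q => // w q vq q_uniq _.
have -> : delete_adjacent [set t in w :: q] v = [set t in q].
  apply/setP=> t; rewrite !inE; case: eqVneq => [->|_] /=.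
    by move: vq q_uniq => /= /andP[-> _] /and3P[_ /negPf -> _].
  by case: (boolP (t \in q)) => // t_q; rewrite (path_not_adj vq q_uniq t_q).
case/andP: vq => _ wq; case/andP: q_uniq => _ q_uniq.
exact: subgraph_det_path wq q_uniq.
Qed.

Lemma chain_path v p z : chain v p z -> path (@adj G) v p /\ uniq (v :: p).
Proof.
case/and3P; rewrite rcons_path => /andP[-> _].
by rewrite -rcons_cons rcons_uniq => /andP[_ ->].
Qed.

Lemma alphaE n (n' : node G) p : chain (val n) p (val n') ->
  alpha n n' = continuant (map (@deco G) p).
Proof.
move=> np; have [vp p_uniq] := chain_path np.
by rewrite /alpha (open_path_chain hG np) (subgraph_det_path vp).
Qed.

Lemma omegaE n (n' : node G) p : chain (val n) p (val n') ->
  omega n n' = continuant_tail (map (@deco G) p).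
Proof.
move=> np; have [vp p_uniq] := chain_path np.
rewrite /omega (open_path_chain hG np); case: p {np} vp p_uniq => [|w p] vp p_uniq.
  by rewrite ifT //; apply/eqP/setP=> t; rewrite !inE.
rewrite ifN; first exact: subgraph_det_path_tail vp p_uniq _.
by apply/set0Pn; exists w; rewrite inE mem_head.
Qed.

Lemma alpha_endE n (u : leaf G) p : chain (val n) p (val u) ->
  alpha_end n u = continuant (map (@deco G) (rcons p (val u))).
Proof.
move=> np; case/and3P: (np) => vp p_uniq _.
by rewrite /alpha_end (half_open_path_chain hG np) (subgraph_det_path vp).
Qed.

Lemma omega_endE n (u : leaf G) p : chain (val n) p (val u) ->
  omega_end n u = continuant_tail (map (@deco G) (rcons p (val u))).
Proof.
move=> np; case/and3P: (np) => vp p_uniq _.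
rewrite /omega_end (half_open_path_chain hG np) (subgraph_det_path_tail vp) //.
by case: (p).
Qed.

Lemma nonnode_deco w : ~~ is_node w -> deco w <= - 2%:Z.
Proof. by rewrite -ltnNge => /(minimal_good hG). Qed.

Lemma alpha_gt0 n (n' : node G) : neighbour n n' -> 0 < alpha n n'.
Proof.
move=> nn'; have /(reachedP hG)[p np] : reached n (inl n') by [].
rewrite (alphaE np); apply: continuant_gt0; rewrite all_map.
by case/and3P: np => _ _; apply: sub_all => w; exact: nonnode_deco.
Qed.

Lemma alpha_end_gt0 n (u : leaf G) : end_of n u -> 0 < alpha_end n u.
Proof.
move=> nu; have /(reachedP hG)[p np] : reached n (inr u) by [].
rewrite (alpha_endE np); apply: continuant_gt0; rewrite all_map all_rcons /=.
rewrite nonnode_deco ?end_nonnode ?(valP u) //.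
by case/and3P: np => _ _; apply: sub_all => w; exact: nonnode_deco.
Qed.

Lemma alpha_first_step x n (n' : node G) :
    (forall w, ~~ is_node w -> pairing x w = 0) -> neighbour n n' ->
  alpha n n' * x (first_step n (inl n')) = omega n n' * x (val n) + x (val n').
Proof.
move=> harm nn'; have /(reachedP hG)[p np] : reached n (inl n') by [].
rewrite (alphaE np) (omegaE np) (first_stepE hG np); apply: chain_relation (np) _.
by move=> w w_p; apply: harm; case/and3P: np => _ _ /allP; apply.
Qed.

Lemma alpha_end_first_step x n (u : leaf G) :
    (forall w, ~~ is_node w -> pairing x w = 0) -> end_of n u ->
  alpha_end n u * x (first_step n (inr u)) = omega_end n u * x (val n).
Proof.
move=> harm nu; have /(reachedP hG)[p np] : reached n (inr u) by [].
rewrite (alpha_endE np) (omega_endE np) (first_stepE hG np).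
apply: leg_relation (np) (valP u) _ => w.
rewrite mem_rcons inE => /orP[/eqP ->|w_p]; apply: harm.
  exact: end_nonnode (valP u).
by case/and3P: np => _ _ /allP; apply.
Qed.

(** The orbifold Euler number of the node [n]. *)
Definition orbifold_diag n : rat :=
  (deco (val n))%:~R + \sum_(n' | neighbour n n') omega_alpha n n'
  + \sum_(u | end_of n u) (omega_end n u)%:~R / (alpha_end n u)%:~R.

(** The entries of minus the orbifold intersection matrix. *)
Definition orbifold_entry n (n' : node G) : rat :=
  - orbifold_diag n * (n' == n)%:R - (neighbour n n')%:R / (alpha n n')%:~R.

Lemma orbifold_formE (l : node G -> rat) n :
  \sum_n' orbifold_entry n n' * l n' =
  - orbifold_diag n * l n - \sum_(n' | neighbour n n') l n' / (alpha n n')%:~R.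
Proof.
under eq_bigr do rewrite mulrBl; rewrite sumrB (bigD1 n) //= eqxx mulr1; congr (_ - _).
  by rewrite big1 ?addr0 // => n' /negPf ->; rewrite mulr0 mul0r.
rewrite [RHS]big_mkcond; apply: eq_bigr => n' _.
by case: neighbour; rewrite ?mul0r // mul1r mulrC.
Qed.

(** A vector orthogonal to all non-nodes is determined by its restriction to
    the nodes, and on such vectors the intersection form is the orbifold form. *)
Lemma orbifold_form_restriction x n : (forall w, ~~ is_node w -> pairing x w = 0) ->
  \sum_n' orbifold_entry n n' * (x (val n'))%:~R = - (pairing x (val n))%:~R.
Proof.
move=> harm; rewrite orbifold_formE pairingE (sum_adj_node hG) mulNr -opprD.
rewrite !rmorphD rmorphM !rmorph_sum /= !mulrDl !mulr_suml; congr (- _).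
rewrite -!addrA; congr (_ + _); rewrite [X in _ + X]addrC addrA -big_split /=.
congr (_ + _).
  apply: eq_bigr => n' nn'; rewrite /omega_alpha mulrAC -mulrDl.
  rewrite -intrM -intrD -(alpha_first_step harm nn').
  by rewrite intrM mulrC mulKf // intr_eq0 gt_eqF ?alpha_gt0.
apply: eq_bigr => u nu; rewrite mulrAC -intrM -(alpha_end_first_step harm nu).
by rewrite intrM mulrC mulKf // intr_eq0 gt_eqF ?alpha_end_gt0.
Qed.

(** The vectors are the columns of the adjugate of the intersection matrix,
    scaled by [- m ^ 2 * d], where [d] is its determinant. A multiple of [m]
    suffices for divisibility; the squares make [k] positive. *)
Lemma dual_vectors (m : int) : m != 0 ->
  exists2 k : int, 0 < k & forall v, exists2 x : vert G -> int,
    forall z, (m %| x z)%Z & forall w, pairing x w = - (k *+ (w == v)).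
Proof.
move=> m_neq0; set A := \matrix_(i < #|vert G|, j < #|vert G|)
  (inter (enum_val i) (enum_val j) : int).
have sumE (F : vert G -> int) : \sum_z F z = \sum_(i < #|vert G|) F (enum_val i).
  by rewrite big_enum_val.
have det_neq0 : \det A != 0.
  apply/det0P=> -[u u_neq0 uA0].
  pose x : {ffun vert G -> int} := [ffun z => u 0 (enum_rank z)].
  have x_neq0 : x != 0.
    apply: contraNneq u_neq0 => x0; apply/eqP/rowP=> i; rewrite mxE.
    by have /ffunP/(_ (enum_val i)) := x0; rewrite !ffunE enum_valK.
  have := negative_definite hG x_neq0.
  rewrite /lattice_form exchange_big big1 ?ltxx //=.
  move=> w _; under eq_bigr do rewrite mulrAC; rewrite -mulr_suml.
  suff -> : \sum_z x z * inter z w = 0 by rewrite mul0r.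
  have /rowP/(_ (enum_rank w)) := uA0; rewrite !mxE => eq0; rewrite sumE -[RHS]eq0.
  by apply: eq_bigr => i _; rewrite !mxE ffunE enum_valK enum_rankK.
pose d := \det A.
exists (m ^+ 2 * d ^+ 2) => [|v].
  by rewrite -exprMn lt0r sqr_ge0 andbT expf_neq0 ?mulf_neq0.
exists (fun z => m ^+ 2 * d * - (\adj A) (enum_rank z) (enum_rank v)).
  by move=> z; rewrite -mulrA dvdz_mulr // dvdz_exp.
move=> w; rewrite /pairing sumE.
have := mul_mx_adj A => /matrixP/(_ (enum_rank w) (enum_rank v)); rewrite !mxE.
rewrite (inj_eq enum_rank_inj) => eq_d.
under eq_bigr do rewrite enum_valK mulrCA mulrN.
rewrite -mulr_sumr sumrN mulrN; congr (- _).
rewrite -mulr_natr -[_ *+ _ in RHS]mulr_natr.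
transitivity (m ^+ 2 * d * (d *+ (w == v))); last by rewrite -[d *+ _]mulr_natr; ring.
rewrite -eq_d; congr (_ * _); apply: eq_bigr => i _.
by rewrite !mxE enum_rankK.
Qed.

End Seifert.

(** * Lattice points of simplicial regions *)

Section Submonoids.
Variables (T : zmodType) (M : set T).
Hypothesis (hM : submonoid M).

Lemma submonoid_mulrn x c : M x -> M (x *+ c).
Proof.
case: hM => M0 MD Mx; elim: c => [|c IHc]; rewrite ?mulr0n // mulrS; exact: MD.
Qed.

Lemma submonoid_sum (I : Type) (r : seq I) (F : I -> T) :
  (forall i, M (F i)) -> M (\sum_(i <- r) F i).
Proof. by case: hM => M0 MD MF; apply: big_ind. Qed.

Lemma submonoid_sum_seq (r : seq T) (F : T -> T) :
  (forall g, g \in r -> M (F g)) -> M (\sum_(g <- r) F g).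
Proof. by case: hM => M0 MD MF; rewrite big_seq; apply: big_ind. Qed.

End Submonoids.

(** Here [fg_monoid] speaks of one exponent for each element of the group, so
    that a generator listed twice is counted twice; this is why duplicates are
    removed from [s]. *)
Lemma fg_monoid_smallest (T : zmodType) (M : set T) (s : seq T) :
    submonoid M -> (forall g, g \in s -> M g) ->
    (forall H : set T, submonoid H -> (forall g, g \in s -> H g) ->
      forall x, M x -> H x) ->
  fg_monoid M.
Proof.
move=> hM Ms M_min; exists (undup s); apply/predeqP => x; split; last first.
  case=> c ->; apply: submonoid_sum_seq => // g; rewrite mem_undup => /Ms.
  exact: submonoid_mulrn.
move: x; apply: M_min.
  split; first by exists (fun=> 0%N); rewrite big1.
  move=> x y [c ->] [d ->]; exists (fun g => c g + d g)%N.
  by rewrite -big_split; apply: eq_bigr => g _; rewrite mulrnDr.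
move=> g g_s; exists (fun h => (h == g) : nat).
rewrite (bigD1_seq g) ?mem_undup ?undup_uniq //= eqxx mulr1n big1 ?addr0 //.
by move=> h /negPf ->.
Qed.

Section Generation.
Variable (I : finType).
Implicit Types (l y : {ffun I -> int}) (i j : I).

Lemma finite_box (N : nat) :
  exists s : seq {ffun I -> int}, forall l, (forall i, `|l i| <= N%:Z) -> l \in s.
Proof.
(* The value 0 to 2 * N of f encodes -N to N. *)
exists [seq [ffun i => (f i : nat)%:Z - N%:Z] | f : {ffun I -> 'I_(2 * N).+1}].
move=> l l_le; apply/imageP.
exists [ffun i => inord (absz (l i + N%:Z))] => //; apply/ffunP=> i; rewrite !ffunE.
have := l_le i; rewrite ler_norml => /andP[l_ge l_le_N]; rewrite inordK; last by lia.
by rewrite gez0_abs ?addrK // -lerBlDr sub0r.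
Qed.

(** One-sided inverses are two-sided, for square matrices indexed by an
    arbitrary finite type. *)
Lemma mulmx1C_fun (R : comNzRingType) (a b : I -> I -> R) :
    (forall i j, \sum_m a i m * b m j = (i == j)%:R) ->
  forall i j, \sum_m b i m * a m j = (i == j)%:R.
Proof.
move=> ab i j.
pose A := \matrix_(i0 < #|I|, j0 < #|I|) a (enum_val i0) (enum_val j0).
pose B := \matrix_(i0 < #|I|, j0 < #|I|) b (enum_val i0) (enum_val j0).
have AB : A *m B = 1%:M.
  apply/matrixP=> i0 j0; rewrite !mxE -(inj_eq enum_val_inj) -ab [RHS]big_enum_val.
  by apply: eq_bigr => m _; rewrite !mxE.
have /matrixP/(_ (enum_rank i) (enum_rank j)) := mulmx1C AB.
rewrite !mxE (inj_eq enum_rank_inj) => <-; rewrite [LHS]big_enum_val.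
by apply: eq_bigr => m _; rewrite !mxE !enum_rankK.
Qed.

Variables (a : I -> I -> rat) (m k : int) (v : I -> {ffun I -> int}).
Hypotheses (k_gt0 : 0 < k) (m_dvd_v : forall i j, (m %| v i j)%Z).

Definition linear_form l i : rat := \sum_j a i j * (l j)%:~R.

Hypothesis form_v : forall i j, linear_form (v j) i = (k *+ (i == j))%:~R.

Lemma linear_formD l y i : linear_form (l + y) i = linear_form l i + linear_form y i.
Proof. by rewrite -big_split; apply: eq_bigr => j _; rewrite ffunE intrD mulrDr. Qed.

Lemma linear_form_mulrn l c i : linear_form (l *+ c) i = linear_form l i *+ c.
Proof.
elim: c => [|c IHc]; last by rewrite !mulrS linear_formD IHc.
by rewrite !mulr0n /linear_form big1 // => j _; rewrite ffunE mulr0.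
Qed.

Lemma linear_form0 i : linear_form 0 i = 0.
Proof. by rewrite -(mulr0n 0) linear_form_mulrn mulr0n. Qed.

Lemma linear_form_comb (c : I -> nat) i :
  linear_form (\sum_j v j *+ c j) i = k%:~R *+ c i.
Proof.
have -> : linear_form (\sum_j v j *+ c j) i = \sum_j linear_form (v j *+ c j) i.
  by apply: (big_morph (linear_form^~ i)) => [x y|];
    rewrite ?linear_formD ?linear_form0.
rewrite (bigD1 i) //= big1 ?addr0 => [|j j_neq].
  by rewrite linear_form_mulrn form_v eqxx.
by rewrite linear_form_mulrn form_v eq_sym (negPf j_neq) mul0rn.
Qed.

Lemma dvd_comb (c : I -> nat) i : (m %| (\sum_j v j *+ c j) i)%Z.
Proof.
rewrite sum_ffunE; apply: rpred_sum => j _.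
by rewrite ffunMnE; apply: rpredMn; exact: m_dvd_v.
Qed.

(** The vectors [v] invert the matrix [a], so bounds on the linear forms bound
    the coordinates. *)
Lemma finite_form_bounded (K : I -> rat) :
  exists s : seq {ffun I -> int},
    forall l, (forall i, `|linear_form l i| <= K i) -> l \in s.
Proof.
have k_neq0 : (k%:~R : rat) != 0 by rewrite intr_eq0 gt_eqF.
have inv_v i j : \sum_i0 ((v i0 i)%:~R / k%:~R) * a i0 j = (i == j)%:R.
  apply: (mulmx1C_fun (b := fun m0 j0 => (v j0 m0)%:~R / k%:~R)) => i1 j1.
  under eq_bigr do rewrite mulrA; rewrite -mulr_suml -/(linear_form (v j1) i1) form_v.
  by case: eqP => _; rewrite ?mul0r // divff.
have lE l i : (l i)%:~R = \sum_j ((v j i)%:~R / k%:~R) * linear_form l j.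
  transitivity (\sum_j0 (i == j0)%:R * (l j0)%:~R : rat).
    rewrite (bigD1 i) //= eqxx mul1r big1 ?addr0 // => j j_neq.
    by rewrite eq_sym (negPf j_neq) mul0r.
  under eq_bigr => j0 _ do rewrite -inv_v mulr_suml.
  rewrite exchange_big; apply: eq_bigr => j _; rewrite mulr_sumr.
  by apply: eq_bigr => j0 _; rewrite mulrA.
pose b i : rat := \sum_j `|(v j i)%:~R / k%:~R| * `|K j|.
have [s s_box] := finite_box (Num.bound (\sum_i b i)).
have b_ge0 i : 0 <= b i by apply: sumr_ge0 => j _; apply: mulr_ge0.
exists s => l l_le; apply: s_box => i; rewrite -(ler_int rat).
apply: le_trans (ltW (archi_boundP _)); last exact: sumr_ge0.
rewrite intr_norm lE; apply: (@le_trans _ _ (b i)).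
  apply: le_trans (ler_norm_sum _ _ _) _; apply: ler_sum => j _.
  rewrite normrM ler_wpM2l //; apply: le_trans (l_le j) (ler_norm _).
by rewrite (bigD1 i) //= lerDl sumr_ge0.
Qed.

Section Region.
Variables (C : set {ffun I -> int}) (N : {ffun I -> int} -> I -> rat) (B : I -> rat).
Hypothesis C_periodic : forall l y, (forall i, (m %| y i)%Z) -> C l -> C (l + y).
Hypothesis N_periodic : forall l y, (forall i, (m %| y i)%Z) ->
  forall i, N (l + y) i = N l i + linear_form y i.
Hypothesis N_bound : forall l i, `|N l i - linear_form l i| <= B i.

Definition region : set {ffun I -> int} :=
  [set l | C l /\ forall i, 0 <= N l i]%classic.

(** Subtracting [v i] from [l] as many times as [k] goes into [N l i] brings
    every [N l i] into the interval from 0 to [k], where only finitely many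
    lattice points remain. *)
Lemma region_decomposition : exists s : seq {ffun I -> int},
  (forall d, d \in s -> region d) /\
  forall l, region l -> exists d (c : I -> nat), d \in s /\ l = d + \sum_j v j *+ c j.
Proof.
have [s0 s0_in] := finite_form_bounded (fun i => B i + k%:~R).
exists [seq d <- s0 | `[< region d >]]; split.
  by move=> d; rewrite mem_filter => /andP[/asboolP].
move=> l [Cl N_ge0]; pose c i := `|Num.floor (N l i / k%:~R)|%N.
set w := \sum_j v j *+ c j.
have k_gt0' : 0 < (k%:~R : rat) by rewrite ltr0z.
have dvd_Nw i : (m %| (- w) i)%Z by rewrite ffunE rpredN dvd_comb.
have form_Nw i : linear_form (- w) i = - (k%:~R *+ c i).
  apply/eqP; rewrite -addr_eq0 -(linear_form_comb c).
  by rewrite -linear_formD addNr linear_form0.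
have cE i : (c i)%:R = (Num.floor (N l i / k%:~R))%:~R :> rat.
  by rewrite /c natr_absz ger0_norm // floor_ge0 divr_ge0 // ltW.
have Nd i : 0 <= N (l - w) i < k%:~R.
  rewrite N_periodic // form_Nw -mulr_natr cE.
  have := floor_itv (N l i / k%:~R); rewrite ler_pdivlMr // ltr_pdivrMr // intrD.
  by move: (_%:~R : rat) => f; lra.
exists (l - w), c; rewrite subrK; split=> //; rewrite mem_filter; apply/andP; split.
  by apply/asboolP; split=> [|i]; [exact: C_periodic | case/andP: (Nd i)].
apply: s0_in => i; have := N_bound (l - w) i; have := Nd i.
move: (N _ _) (linear_form _ _) (B i) => N1 f1 B1.
rewrite !ler_norml; lra.
Qed.

Lemma region_fg_module (M : set {ffun I -> int}) :
  submonoid M -> (forall i, M (v i)) -> is_module M region -> fg_module M region.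
Proof.
move=> hM Mv modM; split=> //; have [s [s_in s_gen]] := region_decomposition.
exists s; split=> //; apply/predeqP => l; split; last first.
  by case=> d [x [d_s Mx ->]]; rewrite addrC; apply: modM => //; exact: s_in.
move=> /s_gen[d [c [d_s ->]]]; exists d, (\sum_j v j *+ c j); split=> //.
by apply: submonoid_sum => // i; apply: submonoid_mulrn.
Qed.

Lemma region_affine : submonoid region -> (forall i, region (v i)) ->
  affine_monoid region.
Proof.
move=> hR Rv; split=> //; have [s [s_in s_gen]] := region_decomposition.
apply: (fg_monoid_smallest (s := s ++ [seq v i | i : I])) => //.
  by move=> g; rewrite mem_cat => /orP[/s_in //|/imageP[i _ ->]].
move=> H hH Hs l /s_gen[d [c [d_s ->]]]; case: (hH) => _ HD; apply: HD.
  by apply: Hs; rewrite mem_cat d_s.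
apply: submonoid_sum => // i; apply: submonoid_mulrn => //; apply: Hs.
by rewrite mem_cat orbC image_f.
Qed.

End Region.
End Generation.

(** * The sets attached to a reduced lift *)

Lemma frac_ge0 x : 0 <= frac x.
Proof. by rewrite subr_ge0 floor_le. Qed.

Lemma frac_lt1 x : frac x < 1.
Proof. by rewrite ltrBlDl; have := floorD1_gt x; rewrite intrD. Qed.

Lemma fracD_int x (z : int) : frac (x + z%:~R) = frac x.
Proof. by rewrite /frac floorDrz // intrKfloor intrD opprD addrACA subrr addr0. Qed.

Lemma frac_int (z : int) : frac z%:~R = 0.
Proof. by rewrite /frac intrKfloor subrr. Qed.

(** This is superadditivity of the floor function. *)
Lemma fracD_le x y : frac (x + y) <= frac x + frac y.
Proof.
rewrite /frac addrACA -opprD lerD2l lerN2 -intrD ler_int floor_ge_int intrD.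
by rewrite lerD ?floor_le.
Qed.

Section Sets.
Variables (G : decorated_graph) (hG : resolution_tree G).
Variables (lt : rel (node G)).
Implicit Types (n : node G) (l y : {ffun node G -> int}) (a : reduced_lift G).

Local Notation form := (linear_form (@orbifold_entry G)).
Local Notation congr0 := (congruence_set lt (zero_lift G)).
Local Notation zero := (zero_lift G).

Lemma end_termD a l y n u :
  end_term a (l + y) n u = end_term a l n u + end_term zero y n u.
Proof. by rewrite /end_term /= ffunE -mulrDl -intrD; congr (_%:~R / _); ring. Qed.

Lemma congruence_setD a l y :
  congruence_set lt a l -> congr0 y -> congruence_set lt a (l + y).
Proof.
move=> hl hy n n' nn'; apply/eqP; rewrite -(hl n n' nn') eqz_mod_dvd !ffunE.
have -> : l n + y n + omega n' n * (l n' + y n') - (l n + omega n' n * l n')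
          = y n + omega n' n * y n' - 0 by ring.
by rewrite -eqz_mod_dvd; apply/eqP; exact: hy.
Qed.

Lemma congr0_subgroup : subgroup congr0.
Proof.
have cong0P l : congr0 l <-> forall n n', node_lt lt n n' ->
    (alpha n n' %| l n + omega n' n * l n')%Z.
  split=> hl n n' /hl; first by move=> /eqP; rewrite eqz_mod_dvd subr0.
  by move=> dvd_l; apply/eqP; rewrite eqz_mod_dvd subr0.
split=> [|x y /cong0P hx /cong0P hy]; apply/cong0P => n n' nn'.
  by rewrite !ffunE mulr0 addr0 dvdz0.
have -> : (x - y) n + omega n' n * (x - y) n' =
          (x n + omega n' n * x n') - (y n + omega n' n * y n') by rewrite !ffunE; ring.
by rewrite rpredB ?hx ?hy.
Qed.

Definition Nconst a n : rat :=
  (lift_node a n)%:~R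
  + (\sum_(n' | node_lt lt n n') omega_alpha n n' * (lift_edge a n n')%:~R)
  + (\sum_(n' | node_lt lt n' n) (alpha n n')%:~R^-1 * (lift_edge a n' n)%:~R)
  + \sum_(u | end_of n u) (lift_end a u)%:~R / (alpha_end n u)%:~R.

(** The floors and the fractional parts of the end terms add up, leaving an
    affine function of [l]. *)
Lemma NbarE a l n : Nbar lt a l n = Nconst a n + form l n.
Proof.
rewrite /Nbar /Nfun /linear_form orbifold_formE /orbifold_diag /Nconst.
rewrite -[LHS]addrA -big_split /=.
under [X in _ + X = _]eq_bigr do
  rewrite /frac addrC subrK /end_term intrB intrM mulrBl mulrAC.
by rewrite sumrB -mulr_suml; ring.
Qed.

Lemma Nconst0 n : Nconst zero n = 0.
Proof.
rewrite /Nconst /= !big1 ?addr0 // => i _; rewrite ?mulr0 //.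
by rewrite mul0r.
Qed.

Lemma NbarD a l y n : Nbar lt a (l + y) n = Nbar lt a l n + form y n.
Proof. by rewrite !NbarE linear_formD addrA. Qed.

Lemma Nbar0E l n : Nbar lt zero l n = form l n.
Proof. by rewrite NbarE Nconst0 add0r. Qed.

Definition fractions a l n : rat := \sum_(u | end_of n u) frac (end_term a l n u).

Lemma NfunE a l n : Nfun lt a l n = Nbar lt a l n - fractions a l n.
Proof. by rewrite /Nbar addrK. Qed.

Lemma fractions_ge0 a l n : 0 <= fractions a l n.
Proof. by apply: sumr_ge0 => u _; apply: frac_ge0. Qed.

Lemma fractions_le a l n : fractions a l n <= #|{: leaf G}|%:R.
Proof.
apply: (@le_trans _ _ (\sum_(u | end_of n u) 1)).
  by apply: ler_sum => u _; rewrite ltW ?frac_lt1.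
by rewrite sumr_const ler_nat max_card.
Qed.

Lemma fractionsD_le a l y n :
  fractions a (l + y) n <= fractions a l n + fractions zero y n.
Proof. by rewrite -big_split; apply: ler_sum => u _; rewrite end_termD fracD_le. Qed.

(** The only terms that are not affine are the floors, which are superadditive. *)
Lemma NfunD_ge a l y n :
  Nfun lt a l n + Nfun lt zero y n <= Nfun lt a (l + y) n.
Proof.
rewrite !NfunE NbarD Nbar0E; have := fractionsD_le a l y n.
move: (fractions _ _ _) (fractions _ _ _) (fractions _ _ _) => f1 f2 f3.
by move: (form y n) (Nbar _ _ _ _) => f4 f5; lra.
Qed.

Lemma Nfun_le_Nbar a l n : Nfun lt a l n <= Nbar lt a l n.
Proof. by rewrite NfunE gerBl fractions_ge0. Qed.

Lemma Mset_sub_Mbar a : (Mset lt a `<=` Mbar lt a)%classic.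
Proof. by move=> l [cl N_ge0]; split=> // n; apply: le_trans (Nfun_le_Nbar _ _ _). Qed.

Lemma Mset_module a : is_module (Mset lt zero) (Mset lt a).
Proof.
move=> y l [cy y_ge0] [cl l_ge0]; rewrite addrC; split=> [|n].
  exact: congruence_setD.
by apply: le_trans (NfunD_ge _ _ _ _); apply: addr_ge0.
Qed.

Lemma Mbar_Mbar_module a : is_module (Mbar lt zero) (Mbar lt a).
Proof.
move=> y l [cy y_ge0] [cl l_ge0]; rewrite addrC; split=> [|n].
  exact: congruence_setD.
by rewrite NbarD -Nbar0E addr_ge0.
Qed.

Lemma Mbar_module a : is_module (Mset lt zero) (Mbar lt a).
Proof. by move=> y l /Mset_sub_Mbar; apply: Mbar_Mbar_module. Qed.

Lemma Mset_submonoid : submonoid (Mset lt zero).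
Proof.
split=> [|x y]; last exact: Mset_module.
split=> [|n]; first by case: congr0_subgroup.
rewrite NfunE Nbar0E linear_form0 /fractions big1 ?subr0 // => u _.
by rewrite /end_term /= ffunE mulr0 subr0 mul0r (frac_int 0).
Qed.

Lemma Mbar_submonoid : submonoid (Mbar lt zero).
Proof.
split=> [|x y]; last exact: Mbar_Mbar_module.
by apply: Mset_sub_Mbar; case: Mset_submonoid.
Qed.

Lemma common_multiple : exists2 m : int, 0 < m &
  (forall n (n' : node G), neighbour n n' -> (alpha n n' %| m)%Z) /\
  (forall n (u : leaf G), end_of n u -> (alpha_end n u %| m)%Z).
Proof.
exists (\prod_(n : node G) ((\prod_(n' : node G | neighbour n n') alpha n n') *
                 (\prod_(u : leaf G | end_of n u) alpha_end n u))).
  apply: prodr_gt0 => n _; apply: mulr_gt0; apply: prodr_gt0 => i.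
    exact: alpha_gt0.
  exact: alpha_end_gt0.
by split=> n i ni; rewrite (bigD1 n) //= dvdz_mulr //;
  [apply: dvdz_mulr | apply: dvdz_mull]; rewrite (bigD1 i ni) dvdz_mulr ?dvdzz.
Qed.

Section Periodic.
Variable m : int.
Hypothesis m_alpha : forall n (n' : node G), neighbour n n' -> (alpha n n' %| m)%Z.
Hypothesis m_alpha_end : forall n (u : leaf G), end_of n u -> (alpha_end n u %| m)%Z.

Lemma congr0_dvd y : (forall n, (m %| y n)%Z) -> congr0 y.
Proof.
move=> m_y n n' /andP[/m_alpha alpha_m _]; apply/eqP; rewrite eqz_mod_dvd subr0.
by apply: rpredD; rewrite ?dvdz_mull //; apply: dvdz_trans alpha_m (m_y _).
Qed.

Lemma fractions_periodic a l y n : (forall n, (m %| y n)%Z) ->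
  fractions a (l + y) n = fractions a l n.
Proof.
move=> m_y; apply: eq_bigr => u nu; rewrite end_termD.
have /dvdzP[z eq_z] := dvdz_trans (m_alpha_end nu) (m_y n).
suff -> : end_term zero y n u = (- omega_end n u * z)%:~R by rewrite fracD_int.
rewrite /end_term /= eq_z sub0r mulrA -mulNr intrM mulNr mulfK //.
by rewrite intr_eq0 gt_eqF ?alpha_end_gt0.
Qed.

Lemma Nfun_periodic a l y : (forall n, (m %| y n)%Z) ->
  forall n, Nfun lt a (l + y) n = Nfun lt a l n + form y n.
Proof. by move=> m_y n; rewrite !NfunE fractions_periodic // NbarD addrAC. Qed.

Lemma Nfun0_dvd y n : (forall n, (m %| y n)%Z) -> Nfun lt zero y n = form y n.
Proof.
move=> m_y; rewrite -[y in LHS]add0r Nfun_periodic // NfunE Nbar0E linear_form0.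
rewrite /fractions big1 ?subr0 ?add0r // => u _.
by rewrite /end_term /= ffunE mulr0 subr0 mul0r (frac_int 0).
Qed.

Lemma Mset0_dvd y : (forall n, (m %| y n)%Z) -> (forall n, 0 <= form y n) ->
  Mset lt zero y.
Proof.
by move=> m_y y_ge0; split=> [|n]; [exact: congr0_dvd | rewrite Nfun0_dvd].
Qed.

End Periodic.

(** The [v n] are multiples of the [E_n^*] restricted to the nodes. *)
Lemma dual_basis (m : int) : 0 < m ->
  exists (k : int) (v : node G -> {ffun node G -> int}),
  [/\ 0 < k, forall i j, (m %| v i j)%Z
    & forall i j, form (v j) i = (k *+ (i == j))%:~R].
Proof.
move=> m_gt0; have m_neq0 : m != 0 by rewrite gt_eqF.
have [k k_gt0 dual] := dual_vectors hG m_neq0.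
exists k, (fun n => [ffun n' => projT1 (cid2 (dual (val n))) (val n')]); split=> //.
  by move=> i j; rewrite ffunE; case: cid2.
move=> i j; rewrite /linear_form.
under eq_bigr do rewrite ffunE; case: cid2 => x _ x_dual /=.
rewrite (orbifold_form_restriction hG); first by rewrite x_dual rmorphN /= opprK.
move=> w w_nonnode; rewrite x_dual; case: eqVneq => [eq_w|_]; last by rewrite oppr0.
by rewrite eq_w (valP j) in w_nonnode.
Qed.

Lemma Mset_Mbar_fg :
  (affine_monoid (Mset lt zero) /\ affine_monoid (Mbar lt zero)) /\
  forall a, fg_module (Mset lt zero) (Mset lt a) /\
            fg_module (Mset lt zero) (Mbar lt a).
Proof.
have [m m_gt0 [m_alpha m_alpha_end]] := common_multiple.
have [k [v [k_gt0 m_v form_v]]] := dual_basis m_gt0.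
have Mset_v n : Mset lt zero (v n).
  apply: (Mset0_dvd m_alpha m_alpha_end) => // n'.
  by rewrite form_v ler0z mulrn_wge0 // ltW.
have C_periodic a l y : (forall n, (m %| y n)%Z) ->
    congruence_set lt a l -> congruence_set lt a (l + y).
  by move=> m_y cl; apply: congruence_setD => //; apply: congr0_dvd m_y.
have Nfun_per a := Nfun_periodic m_alpha_end a.
have Nbar_per a l y : (forall n, (m %| y n)%Z) ->
    forall n, Nbar lt a (l + y) n = Nbar lt a l n + form y n.
  by move=> _ n; apply: NbarD.
have Nbar_bound a l n : `|Nbar lt a l n - form l n| <= `|Nconst a n|.
  by rewrite NbarE addrK.
have Nfun_bound a l n :
    `|Nfun lt a l n - form l n| <= `|Nconst a n| + #|{: leaf G}|%:R.
  rewrite NfunE addrAC; apply: le_trans (ler_normB _ _) _; apply: lerD => //.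
  by rewrite ger0_norm ?fractions_ge0 ?fractions_le.
have Mset_fg a := region_fg_module k_gt0 m_v form_v (@C_periodic a) (Nfun_per a)
  (Nfun_bound a) Mset_submonoid Mset_v (@Mset_module a).
have Mbar_fg a := region_fg_module k_gt0 m_v form_v (@C_periodic a) (Nbar_per a)
  (Nbar_bound a) Mset_submonoid Mset_v (@Mbar_module a).
have Mset_affine := region_affine k_gt0 m_v form_v (@C_periodic zero)
  (Nfun_per zero) (Nfun_bound zero) Mset_submonoid Mset_v.
have Mbar_affine := region_affine k_gt0 m_v form_v (@C_periodic zero)
  (Nbar_per zero) (Nbar_bound zero) Mbar_submonoid (fun n => Mset_sub_Mbar (Mset_v n)).
by split=> // a; split; [exact: Mset_fg | exact: Mbar_fg].
Qed.

Lemma Mset_normalization : Mbar lt zero = normalization (Mset lt zero).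
Proof.
have [m m_gt0 [m_alpha m_alpha_end]] := common_multiple.
have [k [v [k_gt0 m_v form_v]]] := dual_basis m_gt0.
apply/predeqP => x; split.
  case=> cx x_ge0; split; last first.
    exists (absz m); first by rewrite absz_gt0 gt_eqF.
    apply: (Mset0_dvd m_alpha m_alpha_end) => n.
      by rewrite ffunMnE -mulr_natl natz gtz0_abs // dvdz_mulr.
    by rewrite linear_form_mulrn mulrn_wge0 // -Nbar0E.
  move=> H [H0 HB] MH.
  (* The fractional parts of x at a node sum to at most the number of ends, and
     adding y compensates for them. *)
  pose y := \sum_n v n *+ #|{: leaf G}|.
  have m_y n : (m %| y n)%Z by apply: dvd_comb.
  have yE n : form y n = k%:~R *+ #|{: leaf G}| by apply: linear_form_comb form_v _ _.
  have y_ge n : #|{: leaf G}|%:R <= form y n.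
    by rewrite yE -[X in _ <= X]mulr_natr ler_peMl // -[1]/(1%:~R) ler_int; lia.
  have My : Mset lt zero y.
    by apply: (Mset0_dvd m_alpha m_alpha_end) => // n; apply: le_trans (y_ge n).
  rewrite -(addrK y x); apply: HB; last exact: MH.
  apply: MH; split=> [|n].
    by apply: congruence_setD cx _; apply: congr0_dvd m_y.
  rewrite (Nfun_periodic m_alpha_end) // NfunE; have := x_ge0 n; have := y_ge n.
  have := fractions_le zero x n.
  move: (fractions _ _ _) (Nbar _ _ _ _) (form _ _) (_%:R) => f1 f2 f3 f4; lra.
case=> gx [c c_gt0 [_ xc_ge0]]; split.
  by apply: gx => [|l []]; first exact: congr0_subgroup.
move=> n; rewrite Nbar0E -(pmulrn_lge0 _ c_gt0) -linear_form_mulrn -Nbar0E.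
exact: le_trans (xc_ge0 n) (Nfun_le_Nbar _ _ _).
Qed.

End Sets.

Theorem lemma4p0p2 (G : decorated_graph) (hG : resolution_tree G)
    (hN : exists v : vert G, is_node v)
    (lt : rel (node G)) (hlt : neighbour_order lt) :
  (affine_monoid (Mset lt (zero_lift G)) /\
   affine_monoid (Mbar lt (zero_lift G)) /\
   Mbar lt (zero_lift G) = normalization (Mset lt (zero_lift G))) /\
  (forall a : reduced_lift G,
     fg_module (Mset lt (zero_lift G)) (Mset lt a) /\
     fg_module (Mset lt (zero_lift G)) (Mbar lt a) /\
     submodule (Mset lt (zero_lift G)) (Mset lt a) (Mbar lt a)).
Proof.
have [[Mset_affine Mbar_affine] fg] := Mset_Mbar_fg hG lt.
split; first by split=> //; split=> //; exact: Mset_normalization.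
move=> a; have [Mset_fg Mbar_fg] := fg a; split=> //; split=> //; split.
- exact: Mset_module.
- exact: Mbar_module.
- exact: Mset_sub_Mbar.
Qed.
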